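(* Let $(\beta,\mathcal{A})$ be a numeration system such that $\mathcal{A}\subset\mathbb{Z}[\beta]$ and $1\in\mathcal{A}[\beta]$. The following statements hold: (1) If $\mathcal{A}[\beta]$ is closed under addition, then $\mathbb{N}[\beta]\subset\mathcal{A}[\beta]$. (2) $\mathcal{A}[\beta]$ is an additive Abelian group if and only if $\mathcal{A}[\beta]=\mathbb{Z}[\beta]$. (3) If $\mathbb{N}\subset\mathcal{A}[\beta]$, then $\beta$ is expanding, i.e., $\beta$ is an algebraic number with all conjugates greater than $1$ in modulus.
   Context: $\mathbb{N}$ contains $0$. $\mathbb{Z}[\beta]$ is the smallest ring containing $\mathbb{Z}$ and $\beta$, i.e. the set of all finite sums $\sum_{i=0}^N x_i\beta^i$ with $x_i\in\mathbb{Z}$; $\mathbb{N}[\beta]$ is the set of all finite sums $\sum_{i=0}^N x_i\beta^i$ with $x_i\in\mathbb{N}$. The conjugates of an algebraic number are all complex roots of its minimal polynomial over $\mathbb{Q}$ (including the number itself). A numeration system is a pair $(\beta,\mathcal{A})$ where $\beta\in\mathbb{C}$, $|\beta|>1$ (the base), and $\mathcal{A}\subset\mathbb{C}$ is a finite set containing $0$ (the alphabet). Define $\mathcal{A}[\beta]=\{\sum_{j=0}^n x_j\beta^j : n\in\mathbb{N},\ x_j\in\mathcal{A}\}$. *)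

(* Defs.v *)
From HB Require Import structures.
From mathcomp Require Import all_boot all_order all_algebra.
From mathcomp Require Import complex.
From mathcomp Require Import mathcomp_extra boolp classical_sets functions cardinality reals.

Set Implicit Arguments.
Unset Strict Implicit.
Unset Printing Implicit Defensive.

Import Order.TTheory GRing.Theory Num.Theory.

Local Open Scope classical_set_scope.
Local Open Scope ring_scope.

(* The field of complex numbers is R[i] for R : realType. Its order is partial
   and [`|z|] is the modulus as an element of R[i], so that [1 < `|z|] compares
   two nonnegative reals. *)

Definition numeration_system (R : realType) (beta : R[i]) (A : set R[i]) : Prop :=
  [/\ 1 < `|beta|, finite_set A & A 0].

(* D[beta], for an arbitrary set D of admissible coefficients. Only the values
   c 0, ..., c n of the coefficient sequence c matter. *)
Definition expansions (R : realType) (D : set R[i]) (beta : R[i]) : set R[i] :=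
  [set x | exists (n : nat) (c : nat -> R[i]),
     (forall j, (j <= n)%N -> D (c j)) /\ x = \sum_(j < n.+1) c j * beta ^+ j].

Definition natC (R : realType) : set R[i] := range (fun n : nat => n%:R).

Definition intC (R : realType) : set R[i] := range (fun z : int => z%:~R).

Arguments natC : clear implicits.
Arguments intC : clear implicits.

Definition nat_adjoin (R : realType) (beta : R[i]) : set R[i] :=
  expansions (natC R) beta.

Definition int_adjoin (R : realType) (beta : R[i]) : set R[i] :=
  expansions (intC R) beta.

Definition closed_under_addition (R : realType) (S : set R[i]) : Prop :=
  forall x y, S x -> S y -> S (x + y).

(* S is an Abelian group under the addition of R[i]; commutativity and
   associativity are inherited. *)
Definition additive_group (R : realType) (S : set R[i]) : Prop :=
  [/\ S 0, closed_under_addition S & forall x, S x -> S (- x)].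

Definition minimal_polynomial (R : realType) (x : R[i]) (p : {poly rat}) : Prop :=
  [/\ p \is monic, root (map_poly ratr p) x &
      forall q : {poly rat}, q != 0 -> root (map_poly ratr q) x ->
        (size p <= size q)%N].

Definition conjugate (R : realType) (x y : R[i]) : Prop :=
  exists2 p : {poly rat}, minimal_polynomial x p & root (map_poly ratr p) y.

(* The first conjunct is not redundant: a transcendental number has no
   minimal polynomial, hence no conjugates in the above sense. *)
Definition expanding (R : realType) (beta : R[i]) : Prop :=
  algebraicOver (ratr : rat -> R[i]) beta /\
  forall y, conjugate beta y -> 1 < `|y|.

(* Main.v *)
Require Import Defs.
From mathcomp Require Import all_boot all_order all_algebra.
From mathcomp Require Import complex.
From mathcomp Require Import boolp classical_sets functions cardinality reals.

(** Write E for the set of values at beta of digit strings over A.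

    The first two parts are algebra. Prepending the digit 0 multiplies by beta,
    so E is stable under multiplication by beta; if E is moreover closed under
    addition, then from 1 it reaches every n * beta ^ j and hence all of
    N[beta]. If E is a group, differences of elements of N[beta] give all of
    Z[beta]; conversely E is contained in Z[beta] because A is and Z[beta] is a
    ring, and Z[beta] is a group.

    For the third part, call y a specialization of beta when every rational
    polynomial vanishing at beta vanishes at y. Fix for each digit a a
    polynomial P_a with a = P_a(beta). An expansion of a natural number n is a
    polynomial identity n = sum_j P_(c j)(beta) * beta ^ j, which therefore
    persists with beta replaced by y. If `|y| < 1, the right-hand side is
    bounded by a geometric series, uniformly in n, which is absurd. So every
    specialization of beta has modulus at least 1
    ([norm_specialization_ge1]), and this single fact is used three times.
    - If beta were transcendental, 0 would be a specialization of it.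
    - A conjugate of beta is a specialization of it.
    - If a conjugate y has modulus 1, then 1 / y is its complex conjugate, so
      the polynomials vanishing at y are stable under reversal of their
      coefficients; the same polynomials vanish at beta, so 1 / beta is a
      specialization of beta, although its modulus is less than 1. *)

Set Implicit Arguments.
Unset Strict Implicit.
Unset Printing Implicit Defensive.

Import Order.TTheory GRing.Theory Num.Theory.

Local Open Scope classical_set_scope.
Local Open Scope ring_scope.

(** * Digit expansions and the ring generated by the base *)

Section Expansions.
Variables (R : realType) (beta : R[i]).
Implicit Types (A S : set R[i]) (x y : R[i]).

Lemma expansions_digit A x : A x -> expansions A beta x.
Proof.
move=> Ax; exists 0, (fun=> x); split=> [//|].
by rewrite big_ord1 expr0 mulr1.
Qed.

(** Prepending the digit 0 shifts an expansion. *)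
Lemma expansions_mulbase A x :
  A 0 -> expansions A beta x -> expansions A beta (x * beta).
Proof.
move=> A0 [n [c [Ac ->]]].
exists n.+1, (fun j => if j is k.+1 then c k else 0); split.
  by case=> [|j] //; apply: Ac.
rewrite [RHS]big_ord_recl mul0r add0r mulr_suml.
by apply: eq_bigr => j _; rewrite lift0 exprSr mulrA.
Qed.

Lemma expansions_mulbaseX A x j :
  A 0 -> expansions A beta x -> expansions A beta (x * beta ^+ j).
Proof.
move=> A0 Ex; elim: j => [|j IH]; first by rewrite mulr1.
by rewrite exprSr mulrA; apply: expansions_mulbase.
Qed.

Lemma nat_adjoin_sub_expansions A :
    A 0 -> expansions A beta 1 -> closed_under_addition (expansions A beta) ->
  nat_adjoin beta `<=` expansions A beta.
Proof.
move=> A0 E1 ED x [n [c [Nc ->]]].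
have E0 : expansions A beta 0 by exact: expansions_digit.
apply: big_ind => // j _; apply: expansions_mulbaseX => //.
have [m _ <-] := Nc j (ltn_ord j).
by elim: m => // m IH; rewrite -natr1; apply: ED.
Qed.

(** Evaluation at the base turns the ring operations of Z[beta] into those of
    integer polynomials. *)
Lemma int_adjoinP x :
  int_adjoin beta x <-> exists p : {poly int}, x = (map_poly intr p).[beta].
Proof.
split=> [[n [c [Zc ->]]]|[p ->]].
  apply: (big_ind (fun x => exists p : {poly int}, x = (map_poly intr p).[beta]))
    => [|_ _ [p ->] [q ->]|j _].
  - by exists 0; rewrite rmorph0 horner0.
  - by exists (p + q); rewrite rmorphD hornerD.
  - have [z _ <-] := Zc j (ltn_ord j).
    exists (z%:P * 'X^j).
    by rewrite rmorphM /= map_polyC map_polyXn hornerM hornerC hornerXn.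
exists (size p), (fun j => (p`_j)%:~R); split=> [j _|].
  by exists p`_j.
rewrite (@horner_coef_wide _ (size p).+1).
  by apply: eq_bigr => j _; rewrite coef_map.
by rewrite (leq_trans (size_poly _ _)).
Qed.

Lemma int_adjoin_group : additive_group (int_adjoin beta).
Proof.
split=> [|_ _ /int_adjoinP[p ->] /int_adjoinP[q ->]|_ /int_adjoinP[p ->]];
  apply/int_adjoinP.
- by exists 0; rewrite rmorph0 horner0.
- by exists (p + q); rewrite rmorphD hornerD.
- by exists (- p); rewrite rmorphN hornerN.
Qed.

Lemma expansions_sub_int_adjoin A :
  A `<=` int_adjoin beta -> expansions A beta `<=` int_adjoin beta.
Proof.
have [Z0 ZD _] := int_adjoin_group.
move=> AZ x [n [c [Ac ->]]]; apply: big_ind => // j _.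
have /AZ/int_adjoinP[p ->] := Ac j (ltn_ord j).
apply/int_adjoinP; exists (p * 'X^j).
by rewrite rmorphM /= map_polyXn hornerM hornerXn.
Qed.

(** It suffices to reach the terms z * beta ^ j, and these lie in N[beta] up to
    sign. *)
Lemma int_adjoin_sub_group S :
  additive_group S -> nat_adjoin beta `<=` S -> int_adjoin beta `<=` S.
Proof.
move=> [S0 SD SN] NS x [n [c [Zc ->]]]; apply: big_ind => // j _.
have SX (m : nat) : S (m%:R * beta ^+ j).
  apply: NS; apply: expansions_mulbaseX; first by exists 0%N.
  by apply: expansions_digit; exists m.
have [[m|m] _ <-] := Zc j (ltn_ord j); first exact: SX.
by rewrite NegzE mulrNz mulNr; apply: SN; apply: SX.
Qed.

End Expansions.

(** * Specializations of the base *)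

(** These are the points that the evaluation Q[beta] -> C sending beta to y is
    well defined for; every complex number specializes a transcendental
    beta. *)
Definition specialization (R : realType) (x y : R[i]) :=
  forall q : {poly rat},
    root (map_poly ratr q) x -> root (map_poly ratr q) y.

Section Specializations.
Variable R : realType.
Implicit Types (beta x y : R[i]) (A : set R[i]).

Lemma natr_unbounded x : exists n : nat, ~~ (n%:R <= x).
Proof.
exists (Num.bound `|complex.Re x|); apply/negP; rewrite lecE => /andP[_].
rewrite -(rmorph_nat (real_complex R)) /=.
rewrite leNgt => /negP; apply.
by rewrite (le_lt_trans (ler_norm _)) // archi_boundP.
Qed.

(** Geometric series bound, multiplied out by 1 - `|y|. *)
Lemma norm_power_sum_le (y M : R[i]) n (d : nat -> R[i]) :
    `|y| < 1 -> (forall j, (j < n)%N -> `|d j| <= M) -> 0 <= M ->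
  `|\sum_(j < n) d j * y ^+ j| * (1 - `|y|) <= M.
Proof.
move=> y1 dM M0.
have y1' : 0 <= 1 - `|y| by rewrite subr_ge0 ltW.
apply: (@le_trans _ _ ((M * \sum_(j < n) `|y| ^+ j) * (1 - `|y|))).
  apply: ler_wpM2r => //; rewrite mulr_sumr.
  apply: le_trans (ler_norm_sum _ _ _) _; apply: ler_sum => j _.
  by rewrite normrM normrX ler_wpM2r ?exprn_ge0 ?dM.
rewrite -mulrA [_ * (1 - _)]mulrC -[1 - `|y|]opprB mulNr -subrX1 opprB.
by rewrite ler_piMr // gerBl exprn_ge0.
Qed.

(** If `|y| < 1, specializing the expansions of all natural numbers n to y
    bounds n * (1 - `|y|) by the sum M of the moduli of all specialized
    digits. *)
Lemma norm_specialization_ge1 beta A y :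
    finite_set A -> A `<=` int_adjoin beta -> natC R `<=` expansions A beta ->
  specialization beta y -> ~~ (`|y| < 1).
Proof.
move=> /finite_seqP[s As] AZ NA spec; apply/negP => y1.
have /choice[P PA] a : exists p : {poly rat},
    A a -> a = (map_poly ratr p).[beta].
  have [/AZ/int_adjoinP[p ->]|nAa] := pselect (A a); last by exists 0.
  exists (map_poly intr p) => _; rewrite -map_poly_comp.
  by congr _.[_]; apply: eq_map_poly => z /=; rewrite ratr_int.
pose d a := (map_poly ratr (P a)).[y].
pose M := \sum_(a <- s) `|d a|.
have M0 : 0 <= M by apply: sumr_ge0.
have dM a : A a -> `|d a| <= M.
  rewrite As /= => sa; rewrite /M (big_rem a) //= lerDl.
  by apply: sumr_ge0.
have y1' : 0 < 1 - `|y| by rewrite subr_gt0.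
have [n /negP] := natr_unbounded (M / (1 - `|y|)); apply.
rewrite ler_pdivlMr // -[n%:R]normr_nat.
have [m [c [Ac nE]]] : expansions A beta n%:R by apply: NA; exists n.
suff -> : n%:R = \sum_(j < m.+1) d (c j) * y ^+ j.
  by apply: (@norm_power_sum_le _ _ _ (d \o c)) => // j jm; apply/dM/Ac.
pose q : {poly rat} := \sum_(j < m.+1) P (c j) * 'X^j - n%:R%:P.
have qE x : (map_poly ratr q).[x]
    = \sum_(j < m.+1) (map_poly ratr (P (c j))).[x] * x ^+ j - n%:R.
  rewrite rmorphB /= map_polyC /= ratr_nat hornerD hornerN hornerC rmorph_sum.
  rewrite horner_sum; congr (_ - _); apply: eq_bigr => j _.
  by rewrite rmorphM /= map_polyXn hornerM hornerXn.
have /spec : root (map_poly ratr q) beta.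
  rewrite rootE qE nE subr_eq0; apply/eqP/eq_bigr => j _.
  by rewrite -PA //; apply: Ac (ltn_ord j).
by rewrite rootE qE subr_eq0 => /eqP.
Qed.

(** A minimal polynomial p is coprime to every q not vanishing at x: the
    complement of gcd(p, q) in p vanishes at x, hence is no shorter than p. If q
    does vanish at x, then so does the gcd, which is therefore p itself up to a
    scalar. *)
Lemma conjugate_root x y (q : {poly rat}) :
    conjugate x y ->
  root (map_poly ratr q) x = root (map_poly ratr q) y.
Proof.
move=> [p [pm px pmin] py].
pose g := gcdp p q.
have rootg (z : R[i]) : root (map_poly ratr p) z ->
    root (map_poly ratr g) z = root (map_poly ratr q) z.
  by move=> pz; rewrite gcdp_map root_gcd pz.
rewrite -!rootg //.
have gp : g %| p by exact: dvdp_gcdl.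
have p0 : p != 0 by exact: monic_neq0.
have g0 : g != 0 by exact: dvdpN0 gp p0.
have [gx|ngx] := boolP (root (map_poly ratr g) x).
  have eq_gp : g %= p.
    by rewrite -dvdp_size_eqp // eqn_leq (pmin g g0 gx) dvdp_leq.
  have : map_poly ratr g %= map_poly (ratr : rat -> R[i]) p by rewrite eqp_map.
  by move/eqp_root => ->; rewrite py.
have pE : p = p %/ g * g by rewrite divpK.
have h0 : p %/ g != 0 by rewrite dvdp_div_eq0.
have hx : root (map_poly ratr (p %/ g)) x.
  by move: px; rewrite pE rmorphM /= rootM (negbTE ngx) orbF -pE.
have /size_poly1P[c c0 ->] : size g == 1%N.
  rewrite eqn_leq size_poly_gt0 g0 andbT.
  have := pmin _ h0 hx; rewrite [X in (size (polyseq X) <= _)%N]pE size_mul //.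
  rewrite -size_poly_gt0 in h0.
  by rewrite -subn1 leq_subLR addnC leq_add2r.
by rewrite map_polyC rootC /= fmorph_eq0 (negbTE c0).
Qed.

Definition reverse_poly (q : {poly rat}) : {poly rat} :=
  \poly_(i < size q) q`_(size q - i.+1).

(** Up to a power of x, the reversed polynomial at x is q at 1 / x. *)
Lemma root_reverse_poly (q : {poly rat}) x : x != 0 ->
  root (map_poly ratr (reverse_poly q)) x = root (map_poly ratr q) x^-1.
Proof.
move=> x0.
suff E : (map_poly ratr (reverse_poly q)).[x]
    = x ^+ (size q).-1 * (map_poly ratr q).[x^-1].
  by rewrite !rootE E mulf_eq0 expf_eq0 (negbTE x0) andbF.
rewrite (@horner_coef_wide _ (size q)); last first.
  by rewrite (leq_trans (size_poly _ _)) // size_poly.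
rewrite (@horner_coef_wide _ (size q) (map_poly _ q)) ?size_poly //.
rewrite (reindex_inj rev_ord_inj) mulr_sumr; apply: eq_bigr => j _.
rewrite !coef_map coef_poly /= rev_ord_proof subnSK // subKn 1?ltnW //.
rewrite mulrCA; congr (_ * _).
have -> : (size q).-1 = (size q - j.+1 + j)%N.
  by rewrite -[in LHS](subnK (ltn_ord j)) addnS.
by rewrite exprD exprVn mulfK // expf_neq0.
Qed.

(** Rational polynomials commute with complex conjugation, which is inversion
    on the unit circle. *)
Lemma root_inv_unit_circle (q : {poly rat}) y : `|y| = 1 ->
  root (map_poly ratr q) y -> root (map_poly ratr q) y^-1.
Proof.
move=> y1 qy; rewrite invC_norm y1 expr1n invr1 mul1r.
have := rmorph_root Num.conj qy; rewrite -map_poly_comp.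
by rewrite (eq_map_poly (g := ratr)) // => a /=; rewrite fmorph_rat.
Qed.

(** A conjugate on the unit circle makes the polynomials vanishing at x stable
    under reversal. *)
Lemma specialization_inv x y :
  conjugate x y -> `|y| = 1 -> x != 0 -> specialization x x^-1.
Proof.
move=> xy y1 x0 q qx; have y0 : y != 0 by rewrite -normr_gt0 y1.
rewrite -root_reverse_poly // (conjugate_root _ xy) root_reverse_poly //.
by apply: root_inv_unit_circle => //; rewrite -(conjugate_root _ xy).
Qed.

Lemma expanding_of_nat_expansions beta A :
    1 < `|beta| -> finite_set A -> A `<=` int_adjoin beta ->
  natC R `<=` expansions A beta -> expanding beta.
Proof.
move=> b1 finA AZ NA.
have spec_ge1 y := norm_specialization_ge1 (y := y) finA AZ NA.
split.
  apply: contrapT => trans; suff : ~~ (`|0 : R[i]| < 1) by rewrite normr0 ltr01.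
  apply: spec_ge1 => q qb; have [->|q0] := eqVneq q 0; first by rewrite rmorph0 root0.
  by case: trans; exists q.
move=> y by_.
have : 1 <= `|y|.
  rewrite real_leNgt ?ger0_real //; apply: spec_ge1 => q.
  by rewrite (conjugate_root q by_).
rewrite le_eqVlt => /orP[/eqP y1|//].
have b0 : beta != 0 by rewrite -normr_gt0 (lt_trans _ b1).
have := spec_ge1 _ (specialization_inv by_ (esym y1) b0); apply: contraNT => _.
by rewrite normfV invf_lt1 // (lt_trans _ b1).
Qed.

End Specializations.

Theorem theorem3p5 (R : realType) (beta : R[i]) (A : set R[i])
    (hsys : numeration_system beta A)
    (hA : A `<=` int_adjoin beta)
    (h1 : expansions A beta 1) :
  [/\ closed_under_addition (expansions A beta) ->
        nat_adjoin beta `<=` expansions A beta,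
      additive_group (expansions A beta) <->
        expansions A beta = int_adjoin beta &
      natC R `<=` expansions A beta -> expanding beta].
Proof.
have [b1 finA A0] := hsys.
split.
- exact: nat_adjoin_sub_expansions.
- split=> [E_group|->]; last exact: int_adjoin_group.
  apply/seteqP; split; first exact: expansions_sub_int_adjoin.
  apply: int_adjoin_sub_group => //.
  by have [_ ED _] := E_group; apply: nat_adjoin_sub_expansions.
- exact: expanding_of_nat_expansions.
Qed.
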